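(* Let $\mathcal H$ be a complex separable Hilbert space and let $T \in \mathcal B(\mathcal H)$ with polar decomposition $T = V|T|$. Then $$\|T - V\| = \min\{\|T - X\| : X \in \mathcal I,\ j(V^*V, X^*X) \le 0\} = \min\{\|T - X\| : X \in \mathcal I,\ j(VV^*, XX^* ) \le 0\}.$$ (In particular both minima exist and are attained at $X = V$.)
   Context: $\mathcal B(\mathcal H)$ is the algebra of bounded linear operators on $\mathcal H$, and $\|\cdot\|$ is the operator norm. $\mathcal I$ denotes the set of all partial isometries on $\mathcal H$, i.e. $X \in \mathcal B(\mathcal H)$ with $XX^*X = X$; for such $X$, $X^*X$ is the orthogonal projection onto $\ker(X)^\perp$ and $XX^*$ the orthogonal projection onto $\operatorname{ran}(X)$. $|T| = (T^*T)^{1/2}$. The polar factor of $T$ is the unique $V \in \mathcal I$ with $T = V|T|$ and $\ker V = \ker T$. For orthogonal projections $P, Q$ on $\mathcal H$, define $j(P,Q) := \dim(\operatorname{ran}(P) \cap \ker(Q)) - \dim(\ker(P) \cap \operatorname{ran}(Q)) \in [-\infty, \infty]$ if at least one of these dimensions is finite, and $j(P,Q) := 0$ if both are infinite. *)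

(* Defs.v *)
(* MathComp + MathComp-Analysis (classical_sets, reals, ereal)
   + mathcomp-real-closed's complex numbers R[i]. *)
From mathcomp Require Import all_boot all_algebra.
From mathcomp Require Import all_classical reals ereal.
From mathcomp.real_closed Require Import complex.
Set Implicit Arguments. Unset Strict Implicit. Unset Printing Implicit Defensive.
Import GRing.Theory Num.Theory.
Local Open Scope ring_scope.
Local Open Scope classical_set_scope.

Section Hilbert.
Variable R : realType.
(* a complex vector space H with a candidate inner product *)
Variable H : lmodType R[i].
Variable inner : H -> H -> R[i].

(* norm induced by the inner product *)
Definition hnorm (x : H) : R := Num.sqrt (complex.Re (inner x x)).

(* (H, inner) is a complex separable Hilbert space *)
Definition is_separable_hilbert : Prop :=
  [/\ (forall (a : R[i]) (x y z : H), inner (a *: x + y) z = a * inner x z + inner y z),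
      (forall x y : H, inner y x = (inner x y)^*),
      (forall x : H, 0 <= inner x x),
      (forall x : H, inner x x = 0 -> x = 0) /\
      (* completeness *)
      (forall u : nat -> H,
         (forall e : R, 0 < e -> exists N, forall m n, (N <= m)%N -> (N <= n)%N ->
              hnorm (u m - u n) < e) ->
         exists l : H, forall e : R, 0 < e -> exists N, forall n, (N <= n)%N ->
              hnorm (u n - l) < e)
    & (* separability: a countable dense subset *)
      (exists d : nat -> H, forall (x : H) (e : R), 0 < e -> exists n, hnorm (x - d n) < e)].

(* bounded linear operators: elements of B(H) *)
Definition bounded_op (T : H -> H) : Prop :=
  (forall (a : R[i]) (x y : H), T (a *: x + y) = a *: T x + T y) /\
  (exists M : R, forall x, hnorm (T x) <= M * hnorm x).

(* operator norm *)
Definition opnorm (T : H -> H) : R :=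
  sup [set hnorm (T x) | x in [set x | hnorm x <= 1]].

(* the adjoint *)
Definition is_adjoint (T S : H -> H) : Prop :=
  forall x y : H, inner (T x) y = inner x (S y).

Definition adj (T : H -> H) : H -> H :=
  match pselect (exists S, is_adjoint T S) with
  | left h => proj1_sig (cid h)
  | right _ => T
  end.

(* partial isometries: X X^* X = X *)
Definition partial_isometry (X : H -> H) : Prop :=
  bounded_op X /\ X \o adj X \o X = X.

(* positive operators and |T| = (T^* T)^(1/2) *)
Definition positive_op (A : H -> H) : Prop :=
  bounded_op A /\ forall x, 0 <= inner (A x) x.

Definition is_pos_sqrt (A B : H -> H) : Prop := positive_op A /\ A \o A = B.

Definition absop (T : H -> H) : H -> H :=
  match pselect (exists A, is_pos_sqrt A (adj T \o T)) with
  | left h => proj1_sig (cid h)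
  | right _ => T
  end.

Definition ker (T : H -> H) : set H := [set x | T x = 0].
Definition ran (T : H -> H) : set H := [set y | exists x, y = T x].

(* V is the polar factor of T *)
Definition polar_factor (T V : H -> H) : Prop :=
  [/\ partial_isometry V, T = V \o absop T & ker V = ker T].

(* dimension of a subspace, None meaning infinite *)
Definition lin_indep_in (S : set H) (n : nat) (f : 'I_n -> H) : Prop :=
  (forall i, S (f i)) /\
  (forall c : 'I_n -> R[i], \sum_(i < n) c i *: f i = 0 -> forall i, c i = 0).

Definition has_dim (S : set H) (n : nat) : Prop :=
  (exists f : 'I_n -> H, lin_indep_in S f) /\
  ~ (exists f : 'I_n.+1 -> H, lin_indep_in S f).

Definition dimS (S : set H) : option nat :=
  match pselect (exists n, has_dim S n) with
  | left h => Some (proj1_sig (cid h))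
  | right _ => None
  end.

(* the index j(P, Q) in the extended reals *)
Definition jidx (P Q : H -> H) : \bar R :=
  match dimS (ran P `&` ker Q), dimS (ker P `&` ran Q) with
  | Some a, Some b => ((a%:R : R) - b%:R)%:E
  | Some _, None => -oo%E
  | None, Some _ => +oo%E
  | None, None => 0%E
  end.

End Hilbert.

(* Main.v *)
(* Put d = ||T - X||, A = |T|. Always |Tx| <= (1 + d)|x|. If ran P and ker Q meet only in 0
   (P = V*V, Q = X*X), then P(ran Q) is dense in ran P, and comparing |Xy| = |y| with
   |Ty| = |TPy| for y in ran Q gives |Tx| >= (1 - d)|x| on ran P; if they do meet, the index
   condition yields a unit vector of ran Q killed by T, so d >= 1 and the bound is void.
   Hence (1 - d)|x| <= |Ax| <= (1 + d)|x| on ran P, which for a positive operator gives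
   |Ax - x| <= d|x| there, i.e. ||T - V|| <= d. The second minimum uses the same lower
   bound for T* and X*, transported by V. *)
Require Import Defs.
From mathcomp Require Import all_boot all_order all_algebra.
From mathcomp Require Import all_classical reals ereal.
From mathcomp.real_closed Require Import complex.
From mathcomp Require Import ring lra.
Set Implicit Arguments. Unset Strict Implicit. Unset Printing Implicit Defensive.
Import Order.TTheory GRing.Theory Num.Theory.
Local Open Scope ring_scope.

(** * Archimedean estimates over the reals *)

Lemma inv_succ_small (R : realType) (e : R) :
  0 < e -> exists N : nat, forall n, (N <= n)%N -> n.+1%:R^-1 < e.
Proof.
move=> e0; exists (Num.bound e^-1) => n hn.
rewrite -[e]invrK ltf_pV2 ?posrE ?invr_gt0 //.
apply: lt_le_trans (archi_boundP _) _; first by rewrite invr_ge0 ltW.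
by rewrite ler_nat; exact: leqW.
Qed.

(** [C] may have either sign: a positive [t], tested at [e = t / (2 (|C| + 1))], would satisfy
    [t <= t / 2]. *)
Lemma le0_small (R : realType) (t C : R) :
  (forall e : R, 0 < e -> t <= e * C) -> t <= 0.
Proof.
move=> h; rewrite leNgt; apply/negP => t0.
have C1 : 0 < `|C| + 1 by rewrite ltr_wpDl.
have := h (t / (2 * (`|C| + 1))) (divr_gt0 t0 (mulr_gt0 (ltr0Sn R 1) C1)).
have -> : t / (2 * (`|C| + 1)) * C = t * (C / (2 * (`|C| + 1))) by field; rewrite gt_eqF.
have : C / (2 * (`|C| + 1)) <= 1/2.
  by rewrite ler_pdivrMr ?mulr_gt0 //; have := ler_norm C; lra.
nra.
Qed.

(** * Real part of the inner product, norm, Cauchy-Schwarz *)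

Section HilbertSpace.
Variables (R : realType) (H : lmodType R[i]) (inner : H -> H -> R[i]).
Hypothesis hH : is_separable_hilbert inner.

Local Notation r x y := (complex.Re (inner x y)).
Local Notation nrm := (hnorm inner).
Local Notation "a *r x" := ((real_complex R a) *: x) (at level 40).

Lemma innerC x y : inner y x = conjc (inner x y).
Proof. by case: hH => _ -> _ _ _. Qed.

Lemma ip_sym x y : r x y = r y x.
Proof. by rewrite (innerC y x); case: (inner y x). Qed.

Lemma ipDl x y z : r (x + y) z = r x z + r y z.
Proof.
case: hH => hl _ _ _ _; have := hl 1 x y z; rewrite scale1r mul1r => ->.
exact: raddfD.
Qed.

Lemma inner0l z : inner 0 z = 0.
Proof.
case: hH => hl _ _ _ _; have := hl 1 0 0 z.
rewrite scale1r mul1r addr0 => /eqP; rewrite -subr_eq subrr => /eqP e; by rewrite -e.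
Qed.

Lemma innerZl a x y : inner (a *: x) y = a * inner x y.
Proof. by case: hH => hl _ _ _ _; rewrite -[a *: x]addr0 hl inner0l addr0. Qed.

Lemma ipZl a x y : r (a *r x) y = a * r x y.
Proof. by rewrite innerZl; case: (inner x y) => u v /=; rewrite mul0r subr0. Qed.

Lemma ip0l y : r 0 y = 0.
Proof. by rewrite inner0l. Qed.

Lemma ipNl x y : r (- x) y = - r x y.
Proof. by have := ipDl x (- x) y; rewrite subrr ip0l; lra. Qed.

Lemma ipBl x y z : r (x - y) z = r x z - r y z.
Proof. by rewrite ipDl ipNl. Qed.

Lemma ipDr x y z : r z (x + y) = r z x + r z y.
Proof. by rewrite ip_sym ipDl !(ip_sym z). Qed.

Lemma ipBr x y z : r z (x - y) = r z x - r z y.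
Proof. by rewrite ip_sym ipBl !(ip_sym z). Qed.

Lemma ipNr x y : r x (- y) = - r x y.
Proof. by rewrite ip_sym ipNl ip_sym. Qed.

Lemma ipZr a x y : r y (a *r x) = a * r y x.
Proof. by rewrite ip_sym ipZl ip_sym. Qed.

Lemma ip0r y : r y 0 = 0.
Proof. by rewrite ip_sym ip0l. Qed.

Lemma inner_self_real x : inner x x = real_complex R (r x x).
Proof.
case: hH => _ _ h0 _ _; have := h0 x; case: (inner x x) => u v.
by rewrite lecE /= => /andP[/eqP ->].
Qed.

Lemma ip_ge0 x : 0 <= r x x.
Proof. by case: hH => _ _ h0 _ _; have := h0 x; rewrite lecE /= => /andP[]. Qed.

Lemma ip_eq0 x : r x x = 0 -> x = 0.
Proof. by case: hH => _ _ _ [h0 _] _ e; apply: h0; rewrite inner_self_real e. Qed.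

Lemma ip_inj u v : (forall x, r u x = r v x) -> u = v.
Proof.
move=> h; apply/eqP; rewrite -subr_eq0; apply/eqP; apply: ip_eq0.
by rewrite ipBl h subrr.
Qed.

Lemma hnorm_sqr x : nrm x ^+ 2 = r x x.
Proof. by rewrite /hnorm sqr_sqrtr // ip_ge0. Qed.

Lemma hnorm_ge0 x : 0 <= nrm x.
Proof. exact: sqrtr_ge0. Qed.

Lemma hnorm_eq0 x : nrm x = 0 -> x = 0.
Proof. by move=> e; apply: ip_eq0; rewrite -hnorm_sqr e expr0n. Qed.

Lemma hnorm0 : nrm 0 = 0.
Proof. by rewrite /hnorm ip0l sqrtr0. Qed.

Lemma hnorm_gt0 x : x <> 0 -> 0 < nrm x.
Proof. by move=> xn0; rewrite lt0r hnorm_ge0 andbT; apply/eqP => /hnorm_eq0. Qed.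

Lemma hnormZ a x : nrm (a *: x) = ComplexField.Normc.normc a * nrm x.
Proof.
rewrite /hnorm innerZl innerC innerZl inner_self_real.
have := ip_ge0 x; case: a => u v /=; set t := complex.Re (inner x x) => t0.
rewrite -sqrtrM ?addr_ge0 ?sqr_ge0 //; congr Num.sqrt; ring.
Qed.

Lemma hnormZr a x : nrm (a *r x) = `|a| * nrm x.
Proof. by rewrite hnormZ /= expr0n /= addr0 sqrtr_sqr. Qed.

Lemma hnormN x : nrm (- x) = nrm x.
Proof. by congr Num.sqrt; rewrite ipNl ip_sym ipNl opprK. Qed.

Lemma hnormB_sym x y : nrm (x - y) = nrm (y - x).
Proof. by rewrite -hnormN opprB. Qed.

Lemma cauchy_schwarz x y : r x y <= nrm x * nrm y.
Proof.
have [->|/eqP/hnorm_gt0 x0] := eqVneq x 0; first by rewrite ip0l hnorm0 mul0r.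
have [->|/eqP/hnorm_gt0 y0] := eqVneq y 0; first by rewrite ip0r hnorm0 mulr0.
have := ip_ge0 (nrm y *r x - nrm x *r y).
rewrite ipBl !ipBr !ipZl !ipZr (ip_sym y x) -!hnorm_sqr => h.
have ab := mulr_gt0 x0 y0; rewrite -(ler_pM2l ab); nra.
Qed.

Lemma hnormBZ_sqr a x y :
  nrm (x - a *r y) ^+ 2 = nrm x ^+ 2 - 2 * a * r x y + a ^+ 2 * nrm y ^+ 2.
Proof. by rewrite !hnorm_sqr ipBl !ipBr !ipZl !ipZr (ip_sym y x); ring. Qed.

Lemma hnorm_triangle x y : nrm (x + y) <= nrm x + nrm y.
Proof.
rewrite -(ler_pXn2r (n := 2)) ?nnegrE ?addr_ge0 ?hnorm_ge0 //.
rewrite hnorm_sqr ipDl !ipDr (ip_sym y x) -!hnorm_sqr.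
by have := cauchy_schwarz x y; nra.
Qed.

Lemma hnorm_triangleB x y z : nrm (x - z) <= nrm (x - y) + nrm (y - z).
Proof. by rewrite -{1}(subrK y x) -addrA hnorm_triangle. Qed.

Lemma hnorm_leD x y : nrm x <= nrm (x - y) + nrm y.
Proof. by rewrite -{1}(subrK y x) hnorm_triangle. Qed.

Lemma hnorm_small0 x (C : R) :
  (forall e : R, 0 < e -> nrm x <= e * C) -> x = 0.
Proof.
by move=> /le0_small x0; apply: hnorm_eq0; apply/le_anti; rewrite x0 hnorm_ge0.
Qed.

(** * Orthogonal components and adjoints *)

(* Limits of minimizing sequences make the projection theorem available for
   non-closed subspaces: [z] is the component of [x] orthogonal to the closure of [L]. *)
Lemma orthogonal_component (L : H -> Prop) (x : H) :
  L 0 -> (forall (a : R) u v, L u -> L v -> L (a *r u + v)) ->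
  exists z, (forall u, L u -> r z u = 0) /\
    forall e : R, 0 < e -> exists2 u, L u & nrm (x - u - z) < e.
Proof.
move=> L0 Ll.
pose E := [set nrm (x - u) ^+ 2 | u in L]%classic.
have hasE : has_inf E.
  split; first by exists (nrm (x - 0) ^+ 2); exists 0.
  by exists 0 => _ [u _ <-]; exact: sqr_ge0.
pose D := inf E.
have DL u : L u -> D <= nrm (x - u) ^+ 2.
  by move=> Lu; apply: ge_inf; [exact: hasE.2|exists u].
(* The excess over the infimum is taken to be a square, so that it controls distances and inner
   products linearly. *)
have /choice[v vP] : forall n : nat, exists u, L u /\
    nrm (x - u) ^+ 2 <= D + (n.+1%:R^-1) ^+ 2.
  move=> n; have e0 : 0 < (n.+1%:R^-1 : R) ^+ 2 by rewrite exprn_gt0 // invr_gt0.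
  by have [_ [u Lu <-] /ltW] := inf_adherent e0 hasE; exists u.
have pL u w : L u -> L w -> forall a : R, L (u + a *r w).
  by move=> Lu Lw a; rewrite addrC; exact: Ll.
have near_orth (e : R) u w : 0 <= e -> L u -> nrm (x - u) ^+ 2 <= D + e ^+ 2 -> L w ->
    r (x - u) w <= e * nrm w.
  move=> e0 Lu hu Lw.
  have [->|/eqP/hnorm_gt0 w0] := eqVneq w 0; first by rewrite ip0r hnorm0 mulr0.
  (* Moving [u] along [w] by the optimal amount [p / s^2] lowers the squared distance by
     [p^2 / s^2], which therefore cannot exceed [e^2]. *)
  have := DL _ (pL _ _ Lu Lw (r (x - u) w / nrm w ^+ 2)).
  rewrite opprD addrA hnormBZ_sqr; set p := r (x - u) w; set s := nrm w.
  have -> : nrm (x - u) ^+ 2 - 2 * (p / s ^+ 2) * p + (p / s ^+ 2) ^+ 2 * s ^+ 2 =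
      nrm (x - u) ^+ 2 - p / s ^+ 2 * p by field; rewrite gt_eqF.
  move=> h; have : p / s ^+ 2 * p <= e ^+ 2 by lra.
  rewrite mulrAC ler_pdivrMr ?exprn_gt0 // -exprMn -expr2 => h2.
  have [p0|p0] := leP 0 p; last by rewrite (le_trans (ltW p0)) // mulr_ge0 // ltW.
  by rewrite -(ler_pXn2r (n := 2)) ?nnegrE // mulr_ge0 // ltW.
have half u w : L u -> L w -> D <= nrm (x - (2^-1 : R) *r (u + w)) ^+ 2.
  move=> Lu Lw; apply: DL; rewrite -[_ *r _]addr0; apply: (Ll) => //.
  by rewrite -[u]scale1r; exact: Ll.
(* Parallelogram law: the midpoint of [v m] and [v n] has squared distance at least [D] from [x], so
   their own squared distance is at most [4 q^2]. *)
have cauchy N m n : (N <= m)%N -> (N <= n)%N -> nrm (v m - v n) <= 2 * N.+1%:R^-1.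
  move=> Nm Nn; have [Lm hm] := vP m; have [Ln hn] := vP n.
  have le_inv k : (N <= k)%N -> (k.+1%:R^-1 : R) ^+ 2 <= N.+1%:R^-1 ^+ 2.
    by move=> Nk; rewrite ler_pXn2r ?nnegrE ?invr_ge0 // lef_pV2 ?posrE ?ltr0n // ler_nat.
  have := half _ _ Lm Ln; have := le_inv _ Nm; have := le_inv _ Nn.
  set q := N.+1%:R^-1; have q0 : 0 <= q by rewrite invr_ge0.
  move=> h1 h2 h3; suff : nrm (v m - v n) ^+ 2 <= (2 * q) ^+ 2.
    by rewrite ler_pXn2r ?nnegrE ?hnorm_ge0 // mulr_ge0.
  move: hm hn h1 h2 h3.
  rewrite !hnorm_sqr !(ipDl, ipDr, ipNl, ipNr, ipZl, ipZr).
  rewrite !(ip_sym (v _) x) (ip_sym (v n) (v m)).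
  move: (_ ^+ 2) (n.+1%:R^-1 ^+ 2) => s t; move: q q0 => q q0; lra.
have [l hl] : exists l, forall e : R, 0 < e ->
    exists N, forall n, (N <= n)%N -> nrm (v n - l) < e.
  case: hH => _ _ _ [_ hc] _; apply: hc => e e0.
  have [N hN] := inv_succ_small (divr_gt0 e0 (ltr0Sn R 1)).
  exists N => m n Nm Nn; apply: le_lt_trans (cauchy _ _ _ Nm Nn) _.
  by have := hN N (leqnn N); rewrite ltr_pdivlMr // mulrC.
have near (e : R) : 0 < e -> exists u, [/\ L u, nrm (x - u) ^+ 2 <= D + e ^+ 2
    & nrm (u - l) < e].
  move=> e0; have [N hN] := hl _ e0; have [M hM] := inv_succ_small e0.
  have [Lv hv] := vP (maxn N M).
  exists (v (maxn N M)); split => //; last by apply: hN; exact: leq_maxl.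
  apply: le_trans hv _; rewrite lerD2l ler_pXn2r ?nnegrE ?invr_ge0 ?ltW //.
  by apply: hM; exact: leq_maxr.
exists (x - l); split; last first.
  move=> e /near[u [Lu _ hu]]; exists u => //.
  by rewrite opprB addrC addrA subrK hnormB_sym.
have le0 u : L u -> r (x - l) u <= 0.
  move=> Lu; apply/ler_addgt0Pr => e e0; rewrite add0r.
  (* Near-orthogonality of [x - w] and the bound on [w - l] each cost [k * nrm u], together at most
     [e]; the [+ 1] covers [u = 0]. *)
  pose k := e / (2 * (nrm u + 1)).
  have u0 := hnorm_ge0 u.
  have k0 : 0 < k by apply: divr_gt0 => //; lra.
  have [w [Lw hw hwl]] := near _ k0.
  have := near_orth _ _ _ (ltW k0) Lw hw Lu.
  have := cauchy_schwarz (w - l) u.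
  have : nrm (w - l) * nrm u <= k * nrm u by rewrite ler_wpM2r // ltW.
  have : k * (2 * (nrm u + 1)) = e by rewrite /k; field; rewrite gt_eqF //; lra.
  by rewrite !ipBl; nra.
move=> u Lu; apply/eqP; rewrite eq_le le0 //=.
have := le0 _ (Ll (-1) _ _ Lu L0).
by rewrite addr0 ipZr mulN1r oppr_le0.
Qed.

(** If [f x0] is nonzero and [z] is the component of [x0] orthogonal to the kernel of [f], then
    [x - (f x / f z) z] lies in that kernel; pairing it with [z] represents [f] by a multiple of
    [z]. *)
Lemma riesz (f : H -> R) (M : R) :
  (forall (a : R) x y, f (a *r x + y) = a * f x + f y) ->
  (forall x, f x <= M * nrm x) -> exists s, forall x, f x = r x s.
Proof.
move=> fl fM.
have f0 : f 0 = 0.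
  by have := fl 1 0 0; rewrite scale1r addr0 mul1r => /eqP; rewrite -subr_eq subrr => /eqP.
have [[x0 /eqP fx0]|nf] := pselect (exists x, f x <> 0); last first.
  by exists 0 => x; rewrite ip0r; apply: contrapT => fx; apply: nf; exists x.
have fZ (a : R) x : f (a *r x) = a * f x by rewrite -[_ *r _]addr0 fl f0 addr0.
have fD x y : f (x + y) = f x + f y by have := fl 1 x y; rewrite scale1r mul1r.
have fN x : f (- x) = - f x.
  by apply/eqP; rewrite -addr_eq0 addrC -fD subrr f0.
have [||z [zL zx]] := @orthogonal_component (fun x => f x = 0) x0 => //.
  by move=> a u v fu fv; rewrite fl fu fv mulr0 addr0.
(* [z] is a limit of vectors [x0 - u] with [f u = 0], all of value [f x0]; boundedness of [f]
   carries the value to the limit. *)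
have fz : f z = f x0.
  have fx u : f u = 0 -> f (x0 - u - z) = f x0 - f z by rewrite !fD !fN => ->; rewrite subr0.
  have M0 : 0 <= `|M| by [].
  apply/le_anti/andP; split; rewrite -subr_le0;
    apply: (@le0_small _ _ `|M|) => e /zx[u /fx fu].
  - have -> : f z - f x0 = - f (x0 - u - z) by rewrite fu opprB.
    have := fM (- (x0 - u - z)); rewrite fN hnormN; move: (x0 - u - z) => w.
    by have := ler_norm M; have := hnorm_ge0 w; nra.
  - rewrite -fu; have := fM (x0 - u - z); move: (x0 - u - z) => w.
    by have := ler_norm M; have := hnorm_ge0 w; nra.
have z0 : 0 < nrm z.
  by apply: hnorm_gt0 => z0; move: fx0; rewrite -fz z0 f0 eqxx.
exists ((f z / nrm z ^+ 2) *r z) => x; rewrite ipZr.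
have : f (x - (f x / f z) *r z) = 0 by rewrite fD fN fZ; field; rewrite fz.
move=> /zL; rewrite ipBr ipZr -hnorm_sqr (ip_sym z) => /eqP; rewrite subr_eq0 => /eqP ->.
by field; rewrite fz fx0 gt_eqF.
Qed.

(** * Bounded linear operators and their adjoints *)

Section Linear.
Variable T : H -> H.
Hypothesis Tb : bounded_op inner T.

Lemma bopD x y : T (x + y) = T x + T y.
Proof. by have := Tb.1 1 x y; rewrite !scale1r. Qed.

Lemma bop0 : T 0 = 0.
Proof. by have := bopD 0 0; rewrite addr0 => /eqP; rewrite -subr_eq subrr => /eqP. Qed.

Lemma bopZ a x : T (a *: x) = a *: T x.
Proof. by have := Tb.1 a x 0; rewrite !addr0 bop0 addr0. Qed.

Lemma bopN x : T (- x) = - T x.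
Proof. by rewrite -scaleN1r bopZ scaleN1r. Qed.

Lemma bopB x y : T (x - y) = T x - T y.
Proof. by rewrite bopD bopN. Qed.

Lemma bop_bound : exists2 M : R, 1 <= M & forall x, nrm (T x) <= M * nrm x.
Proof.
have [M hM] := Tb.2; exists (1 + `|M|) => [|x]; first by rewrite lerDl.
apply: le_trans (hM x) _; apply: ler_wpM2r; first exact: hnorm_ge0.
by apply: le_trans (ler_norm M) _; rewrite lerDr.
Qed.

(** Complex linearity of [T] recovers the imaginary parts: they are the real parts at ['i *: x], up
    to sign. *)
Lemma is_adjoint_re S :
  (forall x y, r (T x) y = r x (S y)) -> is_adjoint inner T S.
Proof.
move=> h x y; have := h x y; have := h ('i%C *: x) y.
rewrite bopZ !innerZl ![_ * inner _ _]mulrC !ReiNIm => /oppr_inj.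
by case: (inner _ _) => a b; case: (inner _ _) => c d /= -> ->.
Qed.

(** The default branch of [adj] never occurs: Riesz applied to [x |-> r (T x) y] gives the adjoint
    pointwise in [y]. *)
Lemma adjP : is_adjoint inner T (adj inner T).
Proof.
rewrite /adj; case: pselect => [h|[]]; first by case: (cid h).
have [M M1 hM] := bop_bound.
have /choice[S hS] : forall y, exists s, forall x, r (T x) y = r x s.
  move=> y; apply: (@riesz _ (M * nrm y)) => [a x z|x].
    by rewrite bopD bopZ ipDl ipZl.
  rewrite mulrAC; apply: le_trans (cauchy_schwarz _ _) _.
  by rewrite ler_wpM2r ?hnorm_ge0.
by exists S; apply: is_adjoint_re.
Qed.

Lemma ip_adj x y : r (T x) y = r x (adj inner T y).
Proof. by rewrite adjP. Qed.

Lemma ip_adjl x y : r (adj inner T x) y = r x (T y).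
Proof. by rewrite ip_sym -ip_adj ip_sym. Qed.

(** With [y] the image of [x] under the adjoint, the square of [nrm y] equals [r x (T y)], at most
    [nrm x * (M * nrm y)]; then [nrm y] cancels. *)
Lemma adj_bounded M : (forall x, nrm (T x) <= M * nrm x) ->
  forall x, nrm (adj inner T x) <= M * nrm x.
Proof.
move=> hM x; set y := adj inner T x.
have [->|/eqP/hnorm_gt0 y0] := eqVneq y 0.
  (* [M] comes without a sign; [M * nrm x >= 0] is read off from [hM] itself. *)
  rewrite hnorm0; have [->|/eqP/hnorm_gt0 x0] := eqVneq x 0; first by rewrite hnorm0 mulr0.
  by apply: le_trans (hM x); exact: hnorm_ge0.
rewrite -(ler_pM2r y0) -expr2 hnorm_sqr /y ip_adjl -/y.
apply: le_trans (cauchy_schwarz _ _) _; rewrite mulrC mulrAC.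
by rewrite ler_wpM2r ?hnorm_ge0.
Qed.

Lemma bounded_adj : bounded_op inner (adj inner T).
Proof.
split; last by have [M _ hM] := bop_bound; exists M; exact: adj_bounded.
move=> a x y; apply: ip_inj => z; rewrite ip_sym [RHS]ip_sym; congr complex.Re.
have rP b u v w : inner w (b *: u + v) = conjc b * inner w u + inner w v.
  case: hH => hl _ _ _ _; rewrite innerC hl rmorphD rmorphM /=.
  by rewrite -!innerC.
by rewrite -adjP !rP !adjP.
Qed.

End Linear.

(** * Square roots of positive operators *)

Definition self_adjoint (A : H -> H) := forall x y, r (A x) y = r x (A y).

(* The Riesz-Nagy iteration for [1 - sqrt (1 - B)]; the increments of the operator
   iterates are dominated in norm by those of the scalar iterates started with [B = 1]. *)
Lemma contraction_fixpoint (B : H -> H) :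
  bounded_op inner B -> (forall x, nrm (B x) <= nrm x) -> self_adjoint B ->
  exists Y : H -> H, [/\ bounded_op inner Y, forall x, nrm (Y x) <= nrm x, self_adjoint Y
    & forall x, Y x = (2^-1 : R) *r (B x + Y (Y x))].
Proof.
move=> Bb B1 Bs.
pose y n : R := iter n (fun t => 2^-1 * (1 + t ^+ 2)) 0.
pose Z n := iter n (fun (A : H -> H) x => (2^-1 : R) *r (B x + A (A x))) (fun=> 0).
have yS n : y n.+1 = 2^-1 * (1 + y n ^+ 2) by [].
have ZS n x : Z n.+1 x = (2^-1 : R) *r (B x + Z n (Z n x)) by [].
have y01 n : 0 <= y n <= 1 by elim: n => [|n IH]; rewrite ?yS /=; [lra|nra].
have y_mono n k : y n <= y (n + k)%N.
  elim: k => [|k IH]; first by rewrite addn0.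
  by apply: le_trans IH _; rewrite addnS yS; have := sqr_ge0 (1 - y (n + k)%N); lra.
have Zlin n (a : R[i]) x z : Z n (a *: x + z) = a *: Z n x + Z n z.
  elim: n x z => [|n IH] x z; first by rewrite /= scaler0 addr0.
  rewrite !ZS !IH (Bb.1) scalerA [a * _]mulrC -scalerA -scalerDr; congr (_ *: _).
  by rewrite scalerDr addrACA.
have ZB n x z : Z n (x - z) = Z n x - Z n z.
  by rewrite addrC -scaleN1r Zlin scaleN1r addrC.
have Zs n : self_adjoint (Z n).
  elim: n => [|n IH] u v; first by rewrite ip0l ip0r.
  by rewrite !ZS ipZl ipZr ipDl ipDr Bs !IH.
have norm_half u v : nrm ((2^-1 : R) *r (u + v)) <= 2^-1 * (nrm u + nrm v).
  by rewrite hnormZr gtr0_norm // ler_pM2l // hnorm_triangle.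
have Zn n x : nrm (Z n x) <= y n * nrm x.
  elim: n x => [|n IH] x; first by rewrite hnorm0 mul0r.
  rewrite ZS yS; apply: le_trans (norm_half _ _) _.
  have [y0 _] := andP (y01 n); have := ler_wpM2l y0 (IH x).
  by have := IH (Z n x); have := B1 x; lra.
(* With [W = Z (n + k)], the split [W W - Z Z = (W - Z) W + Z (W - Z)] bounds each new increment by
   half the difference of the squares of the scalar iterates, which is the next scalar increment. *)
have Zd n k x : nrm (Z (n + k)%N x - Z n x) <= (y (n + k)%N - y n) * nrm x.
  elim: n x => [|n IH] x; first by rewrite !add0n !subr0; exact: Zn.
  rewrite addSn !ZS !yS -scalerBr opprD addrACA subrr add0r.
  rewrite -(subrK (Z n (Z (n + k)%N x)) (Z (n + k)%N _)) -addrA -ZB.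
  apply: le_trans (norm_half _ _) _.
  have := IH (Z (n + k)%N x); have := Zn n (Z (n + k)%N x - Z n x).
  have [y0 _] := andP (y01 n); have := ler_wpM2l y0 (IH x).
  have dy : 0 <= y (n + k)%N - y n by rewrite subr_ge0.
  by have := ler_wpM2l dy (Zn (n + k)%N x); lra.
pose E := [set y n | n in [set: nat]]%classic.
have supE : has_sup E.
  by split; [exists (y 0%N), 0%N|exists 1 => _ [n _ <-]; case/andP: (y01 n)].
have yE n : y n <= sup E by apply: ub_le_sup; [exact: supE.2|exists n].
have yN (e : R) : 0 < e -> exists N, forall n, (N <= n)%N -> sup E - y n <= e.
  move=> e0; have [_ [N _ <-] hN] := sup_adherent e0 supE.
  by exists N => n Nn; have := y_mono N (n - N)%N; rewrite subnKC //; lra.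
have Zsup N n x : (N <= n)%N -> nrm (Z n x - Z N x) <= (sup E - y N) * nrm x.
  move=> Nn; have := Zd N (n - N)%N x; rewrite subnKC // => /le_trans; apply.
  by rewrite ler_wpM2r ?hnorm_ge0 // lerD2r.
have /choice[Y hY] : forall x, exists l, forall e : R, 0 < e ->
    exists N, forall n, (N <= n)%N -> nrm (Z n x - l) < e.
  move=> x; case: hH => _ _ _ [_ hc] _; apply: hc => e e0.
  have x1 : 0 < 4 * (nrm x + 1) by have := hnorm_ge0 x; lra.
  have [N hN] := yN _ (divr_gt0 e0 x1).
  exists N => m n Nm Nn; apply: le_lt_trans (hnorm_triangleB _ (Z N x) _) _.
  rewrite (hnormB_sym (Z N x)).
  have := Zsup _ _ x Nm; have := Zsup _ _ x Nn; have := hN _ (leqnn N).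
  by rewrite ler_pdivlMr //; have := yE N; lra.
(* Letting the larger index tend to infinity makes the convergence uniform in operator norm, so each
   property of [Z n] passes to [Y] up to [e] times a fixed constant. *)
have YZ (e : R) : 0 < e -> exists N, forall n, (N <= n)%N ->
    forall x, nrm (Y x - Z n x) <= e * nrm x.
  move=> e0; have [N hN] := yN _ e0; exists N => n Nn x; rewrite -subr_le0.
  apply: (@le0_small _ _ 1) => d d0; rewrite mulr1.
  have [M hM] := hY x _ d0.
  have := hM (maxn M n) (leq_maxl _ _); have := Zsup n (maxn M n) x (leq_maxr _ _).
  have := hnorm_triangleB (Y x) (Z (maxn M n) x) (Z n x); rewrite (hnormB_sym _ (Z (maxn M n) x)).
  by have := ler_wpM2r (hnorm_ge0 x) (hN _ Nn); lra.
have YZn (e : R) : 0 < e -> exists n, forall x,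
    nrm (Y x - Z n x) <= e * nrm x /\ nrm (Y x - Z n.+1 x) <= e * nrm x.
  by move=> /YZ[N hN]; exists N => x; split; apply: hN.
have Y1 x : nrm (Y x) <= nrm x.
  rewrite -subr_le0; apply: (@le0_small _ _ (nrm x)) => e /YZn[n hn].
  have [_ y1] := andP (y01 n); have := ler_wpM2r (hnorm_ge0 x) y1.
  by have := hnorm_leD (Y x) (Z n x); have := (hn x).1; have := Zn n x; lra.
exists Y; split => //.
- split; last by exists 1 => x; rewrite mul1r.
  move=> a x z; apply/eqP; rewrite -subr_eq0; apply/eqP.
  have [c c0 hc] : exists2 c : R, 0 <= c & forall u, nrm (a *: u) = c * nrm u.
    exists (ComplexField.Normc.normc a); last by move=> u; exact: hnormZ.
    by case: (a) => u v; exact: sqrtr_ge0.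
  pose C := nrm (a *: x + z) + (c * nrm x + nrm z).
  apply: (@hnorm_small0 _ C) => e /YZn[n hn].
  have -> : Y (a *: x + z) - (a *: Y x + Y z) = (Y (a *: x + z) - Z n (a *: x + z))
      - (a *: (Y x - Z n x) + (Y z - Z n z)).
    by rewrite Zlin scalerBr addrACA -opprD opprB addrA subrK.
  have := hnorm_triangle (Y (a *: x + z) - Z n (a *: x + z))
    (- (a *: (Y x - Z n x) + (Y z - Z n z))).
  rewrite hnormN.
  have := hnorm_triangle (a *: (Y x - Z n x)) (Y z - Z n z); rewrite hc.
  have := (hn x).1; have := (hn z).1; have := (hn (a *: x + z)).1.
  by have := ler_wpM2l c0 (hn x).1; rewrite /C; lra.
- have Yle u v : r (Y u) v - r u (Y v) <= 0.
    apply: (@le0_small _ _ (2 * (nrm u * nrm v))) => e /YZn[n hn].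
    have := cauchy_schwarz (Y u - Z n u) v; have := cauchy_schwarz (- u) (Y v - Z n v).
    rewrite hnormN ipNl ipBl ipBr Zs.
    have := ler_wpM2r (hnorm_ge0 v) (hn u).1; have := ler_wpM2l (hnorm_ge0 u) (hn v).1.
    by lra.
  move=> u v; apply/eqP; rewrite -subr_eq0; apply/eqP/le_anti; rewrite Yle /=.
  by have := Yle v u; rewrite !(ip_sym v) !(ip_sym _ u); lra.
- move=> x; apply/eqP; rewrite -subr_eq0; apply/eqP.
  apply: (@hnorm_small0 _ (2 * nrm x + nrm (Y x))) => e e0; have [n hn] := YZn e e0.
  apply: le_trans (hnorm_triangleB _ (Z n.+1 x) _) _.
  rewrite ZS -scalerBr opprD addrACA subrr add0r -ZS.
  rewrite -(subrK (Z n (Y x)) (Z n (Z n x))) -addrA -ZB.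
  have := norm_half (Z n (Z n x - Y x)) (Z n (Y x) - Y (Y x)).
  have [_ y1] := andP (y01 n); have := Zn n (Z n x - Y x).
  have := ler_wpM2r (hnorm_ge0 (Z n x - Y x)) y1.
  have := (hn x).1; have := (hn x).2; have := (hn (Y x)).1.
  have := mulr_ge0 (ltW e0) (hnorm_ge0 x); have := mulr_ge0 (ltW e0) (hnorm_ge0 (Y x)).
  by rewrite (hnormB_sym (Z n x)) (hnormB_sym (Z n (Y x))); lra.
Qed.

(** Positivity in the complex order makes the quadratic form real. Polarization then cancels
    imaginary parts, and replacing [x] by ['i *: x] turns these into real parts. *)
Lemma positive_self_adjoint A : positive_op inner A -> self_adjoint A.
Proof.
move=> [Ab Ap].
have ImD u v : complex.Im (inner (A u) v) + complex.Im (inner (A v) u) = 0.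
  have Im0 w : complex.Im (inner (A w) w) = 0 by exact: ger0_Im.
  have hD x y z : inner (x + y) z = inner x z + inner y z.
    by case: hH => hl _ _ _ _; have := hl 1 x y z; rewrite scale1r mul1r.
  have hDr x y z : inner z (x + y) = inner z x + inner z y.
    by rewrite innerC hD rmorphD /= -!innerC.
  have := Im0 (u + v); rewrite (bopD Ab) hD !hDr !raddfD /= !Im0; lra.
move=> x y; have := ImD ('i%C *: x) y.
rewrite (bopZ Ab) innerZl (innerC _ (A y)) innerZl.
by case: (inner (A x) y) => a b; case: (inner x (A y)) => c e /=; lra.
Qed.

(** For [B = 1 - c S T], the fixed point [Y = (B + Y^2) / 2] satisfies [(1 - Y)^2 = 1 - B = c S T];
    since [c = 1 / M^2], the root is [M (1 - Y)]. *)
Lemma sqrt_exists T : bounded_op inner T ->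
  exists A, is_pos_sqrt inner A (adj inner T \o T).
Proof.
move=> Tb; have Sb := bounded_adj Tb; have [M M1 hM] := bop_bound Tb.
set S := adj inner T in Sb *.
have M0 : 0 < M by lra.
pose c : R := (M ^+ 2)^-1.
have c0 : 0 < c by rewrite invr_gt0 exprn_gt0.
have cM : c * M ^+ 2 = 1 by rewrite mulVf // gt_eqF // exprn_gt0.
pose B x := x - c *r S (T x).
(* In the expanded square the quadratic term in [c] is at most [c * nrm (T x) ^+ 2], because
   [c M^2 = 1]; the linear term is twice that with the opposite sign. *)
have B1 x : nrm (B x) <= nrm x.
  rewrite -(ler_pXn2r (n := 2)) ?nnegrE ?hnorm_ge0 // hnormBZ_sqr.
  rewrite -(ip_adj Tb) -hnorm_sqr.
  have h : nrm (S (T x)) ^+ 2 <= M ^+ 2 * nrm (T x) ^+ 2.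
    rewrite -exprMn ler_pXn2r ?nnegrE ?hnorm_ge0 ?mulr_ge0 ?hnorm_ge0 ?(ltW M0) //.
    exact: adj_bounded.
  have : c ^+ 2 * nrm (S (T x)) ^+ 2 <= c * nrm (T x) ^+ 2.
    apply: le_trans (ler_wpM2l (sqr_ge0 c) h) _.
    by rewrite expr2 mulrA -[c * c * _]mulrA cM mulr1.
  by have := mulr_ge0 (ltW c0) (sqr_ge0 (nrm (T x))); lra.
have Bb : bounded_op inner B.
  split; last by exists 1 => x; rewrite mul1r.
  move=> a x y; rewrite /B (bopD Tb) (bopZ Tb) (bopD Sb) (bopZ Sb).
  rewrite scalerDr scalerBr [c%:C%C *: (a *: _)]scalerA [_ * a]mulrC -scalerA.
  by rewrite opprD addrACA.
have Bs : self_adjoint B.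
  by move=> x y; rewrite /B ipBl ipBr ipZl ipZr (ip_adjl Tb) (ip_adj Tb).
have [Y [Yb Y1 Ys Ye]] := contraction_fixpoint Bb B1 Bs.
pose A x := M *r (x - Y x).
have Ab : bounded_op inner A.
  split; last first.
    exists (2 * M) => x; rewrite hnormZr gtr0_norm //.
    have := hnorm_triangle x (- Y x); rewrite hnormN => h.
    have : nrm (x - Y x) <= 2 * nrm x by have := Y1 x; lra.
    by move=> /(ler_wpM2l (ltW M0)); lra.
  move=> a x y; rewrite /A (bopD Yb) (bopZ Yb) opprD addrACA -scalerBr scalerDr.
  by rewrite !scalerA [_ * a]mulrC.
have As : self_adjoint A.
  by move=> x y; rewrite /A ipZl ipZr ipBl ipBr Ys.
exists A; split; first split => //.
  move=> x; rewrite lecE /=; apply/andP; split.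
    have := innerC (A x) x; rewrite -(is_adjoint_re Ab As).
    by case: (inner (A x) x) => u v [hv] /=; apply/eqP; lra.
  rewrite /A ipZl ipBl; apply: mulr_ge0; first exact: ltW.
  have := cauchy_schwarz (Y x) x; have := ler_wpM2r (hnorm_ge0 x) (Y1 x).
  by rewrite -hnorm_sqr; lra.
apply/funext => x /=.
have YY : Y (Y x) = (2 : R) *r Y x - B x.
  rewrite [in RHS]Ye scalerA -rmorphM /= mulfV ?pnatr_eq0 // scale1r.
  by rewrite addrC addKr.
rewrite /A (bopZ Yb) (bopB Yb) YY -scalerBr scalerA.
have -> : x - Y x - (Y x - ((2 : R) *r Y x - B x)) = c *r S (T x).
  have -> : (2 : R) *r Y x = Y x + Y x by rewrite mulr2n rmorphD scalerDl scale1r.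
  have cancel2 u w : u - (u + u - w) = w - u :> H by rewrite opprB addrCA opprD addNKr.
  by rewrite cancel2 /B opprB addrA subrK opprB addrC subrK.
by rewrite !scalerA -!rmorphM /= -expr2 mulrC cM scale1r.
Qed.

Lemma absop_sqrt T : bounded_op inner T -> is_pos_sqrt inner (absop inner T) (adj inner T \o T).
Proof.
by move=> /sqrt_exists h; rewrite /absop; case: pselect => // ?; case: (cid _).
Qed.

(** * Positive operators near the identity *)

(* [r (E x) (F x) >= 0] for [E = A - m] and [F = M - A], read off from
   [(M - m) E F = E F E + F E F]. *)
Lemma form_interval A (K : H -> Prop) (m M : R) : bounded_op inner A -> self_adjoint A ->
  (forall (a b : R) x, K x -> K (a *r A x + b *r x)) -> m < M ->
  (forall x, K x -> m * nrm x ^+ 2 <= r (A x) x) ->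
  (forall x, K x -> r (A x) x <= M * nrm x ^+ 2) ->
  forall x, K x -> nrm (A x) ^+ 2 + m * M * nrm x ^+ 2 <= (m + M) * r (A x) x.
Proof.
move=> Ab As KA mM Am AM x Kx.
have := AM _ (KA 1 (- m) x Kx); have := Am _ (KA (-1) M x Kx).
rewrite !(bopD Ab) !(bopZ Ab) !hnorm_sqr !(ipDl, ipDr, ipZl, ipZr).
rewrite !(ip_sym x (A x)) (As (A x) x).
set n := r x x; set p := r (A x) x; set q := r (A x) (A x); set t := r (A (A x)) (A x).
move=> h1 h2; rewrite -(ler_pM2l (_ : 0 < M - m)) ?subr_gt0 //; lra.
Qed.

(* By [form_interval], the largest lower bound [s] of the form cannot be below [m]:
   it could be improved to [(m^2 + s M) / (s + M)]. *)
Lemma form_lower_bound A (K : H -> Prop) (m : R) : bounded_op inner A -> self_adjoint A ->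
  (forall (a b : R) x, K x -> K (a *r A x + b *r x)) -> 0 <= m ->
  (forall x, K x -> 0 <= r (A x) x) -> (forall x, K x -> m * nrm x <= nrm (A x)) ->
  forall x, K x -> m * nrm x ^+ 2 <= r (A x) x.
Proof.
move=> Ab As KA m0 A0 Am.
pose E := [set a : R | 0 <= a /\ forall x, K x -> a * nrm x ^+ 2 <= r (A x) x]%classic.
have [[a [ma [_ Ea]]]|small] := pselect (exists a, m <= a /\ E a).
  by move=> x Kx; apply: le_trans (Ea x Kx); rewrite ler_wpM2r ?sqr_ge0.
have E0 : E 0 by split=> // x Kx; rewrite mul0r A0.
have Elt a : E a -> a < m.
  by move=> Ea; rewrite ltNge; apply/negP => ma; apply: small; exists a.
have supE : has_sup E by split; [exists 0|exists m => a /Elt/ltW].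
set s := sup E.
have s0 : 0 <= s by apply: ub_le_sup => //; exact: supE.2.
have sm : s <= m by apply: ge_sup; [exact: supE.1|move=> a /Elt/ltW].
have Es : E s.
  split => // x Kx; rewrite -subr_le0; apply: (@le0_small _ _ (nrm x ^+ 2)) => e e0.
  have [a [_ Ea] sa] := sup_adherent e0 supE.
  have := Ea x Kx; have := ler_wpM2r (sqr_ge0 (nrm x)) (ltW sa); rewrite -/s; lra.
have {}sm := Elt _ Es.
have [N N1 hN] := bop_bound Ab.
(* An upper bound of the form that lies strictly above [s], as [form_interval] requires. *)
pose M := N + s.
have sM : s < M by rewrite /M; lra.
have AM x : K x -> r (A x) x <= M * nrm x ^+ 2.
  move=> _; have := cauchy_schwarz (A x) x; have := ler_wpM2r (hnorm_ge0 x) (hN x).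
  by have := mulr_ge0 s0 (sqr_ge0 (nrm x)); rewrite /M; lra.
pose s' := (m ^+ 2 + s * M) / (s + M).
have sM0 : 0 < s + M by lra.
(* After clearing the denominator this is [s^2 < m^2]. *)
have ss' : s < s' by rewrite /s' ltr_pdivlMr //; nra.
suff /(ub_le_sup supE.2) : E s' by rewrite leNgt ss'.
split; first by lra.
move=> x Kx; have := form_interval Ab As KA sM Es.2 AM Kx.
rewrite /s' [_ / _ * _]mulrAC ler_pdivrMr // => h; apply: le_trans (le_trans h _); last by rewrite mulrC.
rewrite mulrDl lerD2r -exprMn ler_pXn2r ?nnegrE ?hnorm_ge0 ?mulr_ge0 ?hnorm_ge0 //.
exact: Am.
Qed.

(** The form of [A] on [K] lies between [1 - d] and [1 + d]; for these bounds [form_interval] is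
    exactly the expanded square of the conclusion. *)
Lemma dist_id_le A (K : H -> Prop) (d : R) : bounded_op inner A -> self_adjoint A ->
  (forall (a b : R) x, K x -> K (a *r A x + b *r x)) -> 0 <= d ->
  (forall x, K x -> 0 <= r (A x) x) ->
  (forall x, K x -> (1 - d) * nrm x <= nrm (A x)) ->
  (forall x, K x -> nrm (A x) <= (1 + d) * nrm x) ->
  forall x, K x -> nrm (A x - x) <= d * nrm x.
Proof.
move=> Ab As KA d0 A0 Al Au.
have Fl x : K x -> (1 - d) * nrm x ^+ 2 <= r (A x) x.
  have [d1|d1] := leP d 1; first by apply: form_lower_bound => //; lra.
  by move=> /A0; have := sqr_ge0 (nrm x); nra.
have Fu x : K x -> r (A x) x <= (1 + d) * nrm x ^+ 2.
  move=> Kx; have := cauchy_schwarz (A x) x; have := ler_wpM2r (hnorm_ge0 x) (Au x Kx); lra.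
move=> x Kx; rewrite -(ler_pXn2r (n := 2)) ?nnegrE ?hnorm_ge0 ?mulr_ge0 ?hnorm_ge0 //.
have := hnormBZ_sqr 1 (A x) x; rewrite rmorph1 scale1r => ->.
(* For [d = 0] the interval degenerates; there the norm of [A x] is at most that of [x], while the
   form is at least [nrm x ^+ 2]. *)
have [d00|dn0] := eqVneq d 0; last first.
  have dlt : 1 - d < 1 + d by move: dn0; rewrite neq_lt; lra.
  have := form_interval Ab As KA dlt Fl Fu Kx; lra.
have := Au x Kx; have := Fl x Kx; rewrite d00 subr0 addr0 !mul1r.
have := hnorm_ge0 x; have := hnorm_ge0 (A x); nra.
Qed.

(** * Partial isometries and polar factors *)

Lemma bounded_op_comp S T :
  bounded_op inner S -> bounded_op inner T -> bounded_op inner (S \o T).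
Proof.
move=> Sb Tb; split; first by move=> a x y /=; rewrite Tb.1 Sb.1.
have [M M1 hM] := bop_bound Sb; have [N _ hN] := bop_bound Tb.
exists (M * N) => x /=; apply: le_trans (hM _) _.
by rewrite -mulrA ler_wpM2l //; lra.
Qed.

Lemma bounded_op_sub S T :
  bounded_op inner S -> bounded_op inner T -> bounded_op inner (fun x => S x - T x).
Proof.
move=> Sb Tb; split.
  by move=> a x y; rewrite Sb.1 Tb.1 scalerBr opprD addrACA.
have [M M1 hM] := bop_bound Sb; have [N _ hN] := bop_bound Tb.
exists (M + N) => x; apply: le_trans (hnorm_triangle _ _) _.
by rewrite hnormN mulrDl lerD.
Qed.

Lemma opnorm_ge0 T : bounded_op inner T -> 0 <= opnorm inner T.
Proof.
move=> Tb; have [M M1 hM] := bop_bound Tb.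
apply: ub_le_sup; last by exists 0; rewrite /= ?(bop0 Tb) hnorm0.
exists M => _ [x x1 <-]; apply: le_trans (hM x) _.
by rewrite -[leRHS]mulr1 ler_wpM2l //; lra.
Qed.

Lemma opnorm_bound T x : bounded_op inner T -> nrm (T x) <= opnorm inner T * nrm x.
Proof.
move=> Tb; have [M M1 hM] := bop_bound Tb.
have [->|/eqP/hnorm_gt0 x0] := eqVneq x 0; first by rewrite (bop0 Tb) hnorm0 mulr0.
rewrite -ler_pdivrMr //; apply: ub_le_sup.
  exists M => _ [y y1 <-]; apply: le_trans (hM y) _.
  by rewrite -[leRHS]mulr1 ler_wpM2l //; lra.
exists ((nrm x)^-1 *r x); first by rewrite /= hnormZr gtr0_norm ?invr_gt0 // mulVf // gt_eqF.
by rewrite (bopZ Tb) hnormZr gtr0_norm ?invr_gt0 // mulrC.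
Qed.

Lemma opnorm_le T (d : R) : 0 <= d -> (forall x, nrm (T x) <= d * nrm x) -> opnorm inner T <= d.
Proof.
move=> d0 hd; apply: ge_sup; first by exists (nrm (T 0)), 0 => //=; rewrite hnorm0.
move=> _ [x x1 <-]; apply: le_trans (hd x) _.
by rewrite -[leRHS]mulr1 ler_wpM2l.
Qed.

Definition orth_proj (P : H -> H) :=
  [/\ bounded_op inner P, self_adjoint P & forall x, P (P x) = P x].

Lemma orth_proj_sqr P x : orth_proj P -> nrm (P x) ^+ 2 = r (P x) x.
Proof. by case=> _ Ps Pi; rewrite hnorm_sqr -Ps Pi. Qed.

Lemma orth_proj_le P x : orth_proj P -> nrm (P x) <= nrm x.
Proof.
move=> Pp; have := cauchy_schwarz (P x) x; rewrite -orth_proj_sqr //.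
by have := hnorm_ge0 (P x); have := hnorm_ge0 x; nra.
Qed.

(** * Dimensions and the index *)

Lemma dimS_triv (S : set H) : (forall x, S x -> x = 0) -> dimS S = Some 0%N.
Proof.
move=> S0; have nindep n (f : 'I_n.+1 -> H) : ~ lin_indep_in S f.
  move=> [Sf fi]; have sum0 : \sum_(i < n.+1) (1 : R[i]) *: f i = 0.
    by rewrite big1 // => i _; rewrite (S0 _ (Sf i)) scaler0.
  by have /eqP := fi _ sum0 ord0; rewrite oner_eq0.
have dim0 : has_dim S 0.
  by split; [exists (fun=> 0); split=> [[]|c _ []]|move=> [f /nindep]].
rewrite /dimS; case: pselect => [h|[]]; last by exists 0%N.
by case: (cid h) => -[|n] //= [[f /nindep]].
Qed.

Lemma dimS_nontriv (S : set H) x : S x -> x <> 0 -> dimS S <> Some 0%N.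
Proof.
move=> Sx x0; rewrite /dimS; case: pselect => // h; case: (cid h) => -[|n] //= [_ []].
exists (fun=> x); split => // c; rewrite big_ord_recl big_ord0 addr0 => cx i.
rewrite ord1; apply/eqP; move/eqP: cx; rewrite scaler_eq0 => /orP[//|/eqP].
by move/x0.
Qed.

(** Both dimensions belong to the same set, so the index is a difference of equal numbers or the
    default 0 of the doubly infinite case. *)
Lemma jidx_refl (P : H -> H) : (jidx P P <= 0)%E.
Proof. by rewrite /jidx setIC; case: dimS => //= n; rewrite subrr. Qed.

(** The second dimension is 0, so the index is the first dimension, or [+oo] if that is infinite. *)
Lemma jidx_le0 (P Q : H -> H) : (jidx P Q <= 0)%E ->
  (forall y, ker P y -> ran Q y -> y = 0) -> forall x, ran P x -> ker Q x -> x = 0.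
Proof.
move=> j0 h x Px Qx; apply: contrapT => x0; move: j0.
have nontriv := @dimS_nontriv (ran P `&` ker Q)%classic x (conj Px Qx) x0.
rewrite /jidx (@dimS_triv (ker P `&` ran Q)%classic); last by move=> y [] /h.
case: dimS nontriv => [n /eqP|_] //; rewrite -?leNgt //.
by rewrite subr0 lee_fin lern0 => /eqP nn /eqP e; case: nn; rewrite e.
Qed.

(* If [ran P] meets [ker Q] trivially then [P (ran Q)] is dense in [ran P]; otherwise the
   index condition yields a nonzero vector of [ran Q] killed by [S = S P]. *)
Lemma partial_isometry_lower_bound S X P Q (d : R) :
  bounded_op inner S -> orth_proj P -> orth_proj Q ->
  (forall x, S (P x) = S x) -> (forall x, nrm (X x) = nrm (Q x)) ->
  (forall x, nrm (S x - X x) <= d * nrm x) -> (jidx P Q <= 0)%E ->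
  forall x, P x = x -> (1 - d) * nrm x <= nrm (S x).
Proof.
move=> Sb Pp Qp SP XQ SX j0 x Px.
have [Pb Ps Pi] := Pp; have [Qb Qs Qi] := Qp.
have [d1|d1] := leP 1 d.
  by apply: le_trans (hnorm_ge0 _); have := hnorm_ge0 x; nra.
(* On such a [y], [S y = S (P y) = 0] while [X] preserves the norm, so [nrm y <= d * nrm y] with
   [d < 1]. *)
have kerran y : ker P y -> ran Q y -> y = 0.
  move=> Py [w yw]; apply: contrapT => /hnorm_gt0 y0.
  have := SX y; rewrite -SP Py (bop0 Sb) sub0r hnormN XQ yw Qi -yw.
  nra.
have [||z [zL zx]] := @orthogonal_component (fun u => exists w, u = P (Q w)) x.
- by exists 0; rewrite (bop0 Qb) (bop0 Pb).
- move=> a _ _ [u ->] [v ->]; exists (a *r u + v).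
  by rewrite (bopD Qb) (bopD Pb) (bopZ Qb) (bopZ Pb).
(* Orthogonality of [z] to all [P (Q w)] means [Q (P z) = 0], so [P z] lies in [ran P] and
   [ker Q]. *)
have Pz : P z = 0.
  apply: (jidx_le0 j0 kerran); first by exists z.
  by apply: ip_inj => w; rewrite Qs Ps ip0l; apply: zL; exists w.
(* [z] is a limit of vectors [x - u] of [ran P], all orthogonal to [z] because [P z = 0]. *)
have z0 : z = 0.
  apply: ip_eq0; apply/le_anti; rewrite ip_ge0 andbT.
  apply: (@le0_small _ _ (nrm z)) => e /zx[u Lu hu].
  have := cauchy_schwarz (- (x - u - z)) z; rewrite hnormN ipNl !ipBl.
  rewrite -{1}Px Ps Pz ip0r (ip_sym u) (zL _ Lu).
  by have := ler_wpM2r (hnorm_ge0 z) (ltW hu); lra.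
have [M M1 hM] := bop_bound Sb.
(* Replacing [x] by [P (Q w)] within [e] costs [(1 - d) e] in the norm of [Q w] and [M e] in the
   value of [S]. *)
rewrite -subr_le0; apply: (@le0_small _ _ ((1 - d) + M)) => e /zx[_ [w ->]].
rewrite z0 subr0 => hw; pose y := Q w.
have h1 := SX y; rewrite /y in h1.
have h2 := hnorm_leD (X (Q w)) (S (Q w)).
have h3 := hnorm_leD (S (Q w)) (S x).
have h4 : nrm (S (Q w) - S x) <= M * e.
  rewrite -SP -(bopB Sb); apply: le_trans (hM _) _; rewrite hnormB_sym.
  by rewrite ler_wpM2l ?ltW //; lra.
have h5 : nrm x - e <= nrm (Q w).
  have := hnorm_leD x (P (Q w)); have := orth_proj_le (Q w) Pp; lra.
have d1' : 0 <= 1 - d by lra.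
have := ler_wpM2l d1' h5; move: h2; rewrite XQ Qi hnormB_sym; lra.
Qed.

(** * Initial and final projections of a partial isometry *)

Section PartialIsometry.
Variable X : H -> H.
Hypothesis Xp : partial_isometry inner X.

Local Notation Xb := (Xp.1).
Local Notation Xs := (adj inner X).

Lemma partial_isometryE x : X (Xs (X x)) = X x.
Proof. by have [_ /(congr1 (@^~ x))] := Xp. Qed.

Lemma partial_isometry_adjE x : Xs (X (Xs x)) = Xs x.
Proof.
by apply: ip_inj => u; rewrite (ip_adjl Xb) (ip_adj Xb) !(ip_adjl Xb) partial_isometryE.
Qed.

Lemma orth_proj_initial : orth_proj (Xs \o X).
Proof.
split; first exact: bounded_op_comp (bounded_adj Xb) Xb.
  by move=> x y /=; rewrite (ip_adjl Xb) (ip_adj Xb).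
by move=> x /=; rewrite partial_isometryE.
Qed.

Lemma orth_proj_final : orth_proj (X \o Xs).
Proof.
split; first exact: bounded_op_comp Xb (bounded_adj Xb).
  by move=> x y /=; rewrite (ip_adj Xb) (ip_adjl Xb).
by move=> x /=; rewrite partial_isometry_adjE.
Qed.

Lemma hnorm_initial x : nrm (X x) = nrm ((Xs \o X) x).
Proof.
apply/eqP; rewrite -(eqrXn2 (n := 2)) ?hnorm_ge0 // (orth_proj_sqr _ orth_proj_initial).
by rewrite hnorm_sqr /= (ip_adjl Xb).
Qed.

Lemma hnorm_final x : nrm (Xs x) = nrm ((X \o Xs) x).
Proof.
apply/eqP; rewrite -(eqrXn2 (n := 2)) ?hnorm_ge0 // (orth_proj_sqr _ orth_proj_final).
by rewrite hnorm_sqr /= (ip_adj Xb).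
Qed.

Lemma partial_isometry_le x : nrm (X x) <= nrm x.
Proof. by rewrite hnorm_initial (orth_proj_le _ orth_proj_initial). Qed.

End PartialIsometry.

Section Polar.

(** * The polar decomposition *)

Variables T V : H -> H.
Hypotheses (Tb : bounded_op inner T) (TV : polar_factor inner T V).

Local Notation A := (absop inner T).
Local Notation Vs := (adj inner V).

Let Vp : partial_isometry inner V. Proof. by case: TV. Qed.
Let Vb : bounded_op inner V := Vp.1.
Let Apos : positive_op inner A := (absop_sqrt Tb).1.
Let Ab : bounded_op inner A := Apos.1.
Let Asa : self_adjoint A := positive_self_adjoint Apos.

Lemma polarE x : T x = V (A x).
Proof. by case: TV => _ TE _; rewrite {1}TE. Qed.

Lemma hnorm_absop x : nrm (A x) = nrm (T x).
Proof.
have AA : A (A x) = adj inner T (T x) by have [_ /(congr1 (@^~ x))] := absop_sqrt Tb.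
by apply/eqP; rewrite -(eqrXn2 (n := 2)) ?hnorm_ge0 // !hnorm_sqr Asa AA (ip_adj Tb).
Qed.

(** [V] kills [Vs (V x) - x], and [ker V] is contained in [ker T]. *)
Lemma polar_initial x : T (Vs (V x)) = T x.
Proof.
have /seteqP[kVT _] : ker V = ker T by case: TV.
have : ker V (Vs (V x) - x) by rewrite /ker /= (bopB Vb) (partial_isometryE Vp) subrr.
by move=> /kVT; rewrite /ker /= (bopB Tb) => /eqP; rewrite subr_eq0 => /eqP.
Qed.

Lemma absop_initial x : A (Vs (V x)) = A x.
Proof.
apply/eqP; rewrite -subr_eq0 -(bopB Ab); apply/eqP; apply: hnorm_eq0.
by rewrite hnorm_absop (bopB Tb) polar_initial subrr hnorm0.
Qed.

(** Adjoint form of [absop_initial]; it makes the initial space of [V] invariant under [A]. *)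
Lemma initial_absop x : Vs (V (A x)) = A x.
Proof.
by apply: ip_inj => u; rewrite (ip_adjl Vb) (ip_adj Vb) Asa absop_initial -Asa.
Qed.

(** [T - V] is [V (A - 1)] after projection to the initial space of [V], so [dist_id_le] applies
    with [K] that space. *)
Lemma polar_dist (d : R) : 0 <= d -> (forall x, nrm (T x) <= (1 + d) * nrm x) ->
  (forall x, Vs (V x) = x -> (1 - d) * nrm x <= nrm (T x)) ->
  opnorm inner (fun x => T x - V x) <= d.
Proof.
move=> d0 Tu Tl; apply: opnorm_le => // x.
pose K y := Vs (V y) = y; pose y := Vs (V x).
have Ky : K y by rewrite /K /y (partial_isometryE Vp).
have -> : T x - V x = V (A y - y).
  by rewrite (bopB Vb) -polarE /y polar_initial (partial_isometryE Vp).
apply: le_trans (partial_isometry_le Vp _) _.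
apply: (@le_trans _ _ (d * nrm y)); last first.
  by rewrite ler_wpM2l // (orth_proj_le x (orth_proj_initial Vp)).
apply: (dist_id_le (K := K)) => //.
- move=> a b z Kz; rewrite /K (bopD Vb) (bopD (bounded_adj Vb)) !(bopZ Vb).
  by rewrite !(bopZ (bounded_adj Vb)) initial_absop Kz.
- by move=> z _; have := Apos.2 z; rewrite lecE => /andP[].
- by move=> z /Tl; rewrite hnorm_absop.
- by move=> z _; rewrite hnorm_absop.
Qed.

Lemma adj_final y : adj inner T (V (Vs y)) = adj inner T y.
Proof.
apply: ip_inj => u; rewrite (ip_adjl Tb) (ip_adj Vb) (ip_adjl Vb) polarE.
by rewrite (partial_isometryE Vp) -polarE (ip_adjl Tb).
Qed.

(** Carries lower bounds for the adjoint of [T] on the final space of [V] back to [A], hence to [T],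
    on the initial space. *)
Lemma adj_polar x : Vs (V x) = x -> adj inner T (V x) = A x.
Proof.
by move=> Vx; apply: ip_inj => u; rewrite (ip_adjl Tb) polarE -(ip_adjl Vb) Vx Asa.
Qed.

Lemma hnorm_polar_initial x : Vs (V x) = x -> nrm (V x) = nrm x.
Proof. by move=> Vx; rewrite (hnorm_initial Vp) /= Vx. Qed.

(** * Comparison with a competing partial isometry *)

Section Competitor.
Variable X : H -> H.
Hypothesis Xp : partial_isometry inner X.
Let Xb : bounded_op inner X := Xp.1.
Local Notation D := (fun x => T x - X x).
Let Db : bounded_op inner D := bounded_op_sub Tb Xb.

(** The upper estimate holds for every partial isometry [X], as [X] does not increase norms; the
    index condition serves only for the lower one. *)
Lemma polar_dist_competitor :
  (forall x, Vs (V x) = x -> (1 - opnorm inner D) * nrm x <= nrm (T x)) ->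
  opnorm inner (fun x => T x - V x) <= opnorm inner D.
Proof.
move=> Tl; apply: polar_dist => // [|x]; first exact: opnorm_ge0.
have := hnorm_leD (T x) (X x); have := opnorm_bound x Db.
by have := partial_isometry_le Xp x; lra.
Qed.

Lemma polar_min_initial : (jidx (Vs \o V) (adj inner X \o X) <= 0)%E ->
  opnorm inner (fun x => T x - V x) <= opnorm inner D.
Proof.
move=> j0; apply: polar_dist_competitor.
apply: (partial_isometry_lower_bound Tb (orth_proj_initial Vp) (orth_proj_initial Xp) _ _ _ j0).
- exact: polar_initial.
- exact: hnorm_initial.
- by move=> x; exact: (opnorm_bound x Db).
Qed.

Lemma polar_min_final : (jidx (V \o Vs) (X \o adj inner X) <= 0)%E ->
  opnorm inner (fun x => T x - V x) <= opnorm inner D.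
Proof.
move=> j0; apply: polar_dist_competitor => x Vx.
have := @partial_isometry_lower_bound (adj inner T) (adj inner X) _ _ (opnorm inner D)
  (bounded_adj Tb) (orth_proj_final Vp) (orth_proj_final Xp) _ _ _ j0 (V x).
rewrite (adj_polar Vx) hnorm_absop (hnorm_polar_initial Vx); apply.
- exact: adj_final.
- exact: hnorm_final.
(* The difference of the adjoints is the adjoint of [D], so it obeys the same norm bound. *)
- move=> y; have -> : adj inner T y - adj inner X y = adj inner D y.
    by apply: ip_inj => u; rewrite ipBl (ip_adjl Tb) (ip_adjl Xb) (ip_adjl Db) ipBr.
  by apply: adj_bounded => // z; exact: (opnorm_bound z Db).
- exact: (partial_isometryE Vp).
Qed.

End Competitor.
End Polar.

End HilbertSpace.

Theorem theorem2p3 (R : realType) (H : lmodType R[i]) (inner : H -> H -> R[i])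
  (hH : is_separable_hilbert inner) (T V : H -> H) :
  bounded_op inner T -> polar_factor inner T V ->
  (* first minimum *)
  ((partial_isometry inner V /\
    (jidx (adj inner V \o V) (adj inner V \o V) <= 0)%E) /\
   forall X : H -> H, partial_isometry inner X ->
     (jidx (adj inner V \o V) (adj inner X \o X) <= 0)%E ->
     opnorm inner (fun x => T x - V x) <= opnorm inner (fun x => T x - X x)) /\
  (* second minimum *)
  ((partial_isometry inner V /\
    (jidx (V \o adj inner V) (V \o adj inner V) <= 0)%E) /\
   forall X : H -> H, partial_isometry inner X ->
     (jidx (V \o adj inner V) (X \o adj inner X) <= 0)%E ->
     opnorm inner (fun x => T x - V x) <= opnorm inner (fun x => T x - X x)).
Proof.
move=> Tb TV; have Vp : partial_isometry inner V by case: TV.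
split; (split; first by split => //; exact: jidx_refl) => X Xp.
- exact: (polar_min_initial hH Tb TV Xp).
- exact: (polar_min_final hH Tb TV Xp).
Qed.
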